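(* Let $G$ be an infinite, locally finite, connected simple graph with a fixed vertex $a$ and let $\psi:G\to\mathbb{C}$. If $M_\psi$ is bounded on $\hat{\mathcal{L}}$ (or equivalently, on $\hat{\mathcal{L}}_0$), then $$\|M_\psi\|_e\le 4A(\psi)+B(\psi),$$ where $$A(\psi)=\lim_{n\to\infty}\sup\{|\psi(v)| : d(a,v)\ge n\},$$ $$B(\psi)=\lim_{n\to\infty}\sup\{d(a,v)|\psi(v)-\psi(w)| : v\sim w,\ d(a,v)\ge n,\ d(a,w)\ge n\},$$ and $\|M_\psi\|_e$ is the essential norm of $M_\psi$ acting on $\hat{\mathcal{L}}$ (respectively, on $\hat{\mathcal{L}}_0$).
   Context: A graph is always connected, undirected, simple, with infinitely many vertices, each of finite degree; $G$ also denotes its vertex set, $v\sim w$ means $v$ and $w$ are adjacent, $N_v=\{w\in G: w\sim v\}$, and $d$ is the graph distance. The Lipschitz space is $\hat{\mathcal{L}}=\{f:G\to\mathbb{C} : \sup_{v\sim w}|f(v)-f(w)|<\infty\}$ with norm $\|f\|_{\hat{\mathcal{L}}}^{a}:=|f(a)|+\sup_{v\sim w}|f(v)-f(w)|$. The little Lipschitz space $\hat{\mathcal{L}}_0$, with the same norm, is the set of $f\in\hat{\mathcal{L}}$ with $\lim_{d(a,v)\to\infty}\max_{w\in N_v}|f(v)-f(w)|=0$ (for every $\epsilon>0$ there is $N\in\mathbb{N}$ with $\max_{w\in N_v}|f(v)-f(w)|<\epsilon$ whenever $d(a,v)>N$). Both are Banach spaces. $M_\psi f:=\psi f$; ''$M_\psi$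 is bounded on $X$'' means $\psi f\in X$ for every $f\in X$ and $M_\psi:X\to X$ is a bounded linear operator. Boundedness of $M_\psi$ on $\hat{\mathcal{L}}$ is equivalent to boundedness on $\hat{\mathcal{L}}_0$, and it implies that $\sup_{v}|\psi(v)|$ and $\sup_{v\sim w}d(a,v)|\psi(v)-\psi(w)|$ are finite, so $A(\psi)$ and $B(\psi)$ exist and are finite (suprema of sets of nonnegative reals; the supremum of the empty set is taken to be $0$). The essential norm of a bounded operator $T$ on a Banach space $X$ is $\|T\|_e=\inf\{\|T-K\| : K \text{ a compact operator on } X\}$. *)

(* Defs.v *)
From HB Require Import structures.
From mathcomp Require Import all_boot all_order all_algebra.
From mathcomp Require Import all_classical all_reals all_analysis.
From mathcomp Require Import complex.

Set Implicit Arguments.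
Unset Strict Implicit.
Unset Printing Implicit Defensive.

Import Order.TTheory GRing.Theory Num.Theory.
Import numFieldNormedType.Exports.

Local Open Scope classical_set_scope.
Local Open Scope ring_scope.

Record graph := Graph {
  vertex :> Type;
  adj : rel vertex;
  adj_sym : symmetric adj;
  adj_irr : irreflexive adj;
  adj_connected : forall v w, exists p, path adj v p /\ last v p = w;
  adj_locally_finite : forall v, finite_set [set w | adj v w];
  vertex_infinite : infinite_set [set: vertex]
}.

Section GraphDistance.
Variable G : graph.

Definition walk_of_size (v w : G) : pred nat :=
  fun n => `[< exists p, [/\ path (@adj G) v p, last v p = w & size p = n] >].

Lemma walk_exists (v w : G) : exists n, walk_of_size v w n.
Proof.
by have [p [vp pw]] := adj_connected v w; exists (size p); apply/asboolP; exists p.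
Qed.

Definition gdist (v w : G) : nat := ex_minn (walk_exists v w).

End GraphDistance.

(* The norm of a normed module over R[i] takes its values in R[i]; [rnorm] is
   the same norm as an element of R. It also gives the modulus on R[i]. *)
Definition rnorm (R : realType) (X : normedZmodType R[i]) (x : X) : R :=
  complex.Re `|x|.

Section Operators.
Variables (R : realType) (X : normedModType R[i]).

Definition bounded_operator (T : X -> X) : Prop :=
  linear T /\ exists M : R, forall x, rnorm (T x) <= M * rnorm x.

Definition operator_norm (T : X -> X) : R :=
  sup [set rnorm (T x) | x in [set x | rnorm x <= 1]].

Definition compact_operator (K : X -> X) : Prop :=
  bounded_operator K /\ precompact (K @` [set x | rnorm x <= 1]).

Definition essential_norm (T : X -> X) : R :=
  inf [set operator_norm (T \- K) | K in [set K | compact_operator K]].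

End Operators.

Section RNorm.
Variable R : realType.

Lemma rnormE (X : normedZmodType R[i]) (x : X) : `|x| = ((rnorm x)%:C)%C.
Proof.
rewrite /rnorm; have := normr_ge0 x; case: `|x| => u v.
by rewrite lecE /= => /andP[/eqP -> _].
Qed.

Lemma rnorm_ge0 (X : normedZmodType R[i]) (x : X) : 0 <= rnorm x.
Proof. by have := normr_ge0 x; rewrite rnormE ler0c. Qed.

Lemma rnormD (X : normedZmodType R[i]) (x y : X) :
  rnorm (x + y) <= rnorm x + rnorm y.
Proof. by have := ler_normD x y; rewrite !rnormE -rmorphD/= lecR. Qed.

Lemma rnorm0 (X : normedZmodType R[i]) : rnorm (0 : X) = 0.
Proof. by rewrite /rnorm normr0. Qed.

Lemma rnorm0_eq0 (X : normedZmodType R[i]) (x : X) : rnorm x = 0 -> x = 0.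
Proof. by move=> x0; apply: normr0_eq0; rewrite rnormE x0. Qed.

Lemma rnormM (x y : R[i]) : rnorm (x * y) = rnorm x * rnorm y.
Proof.
apply: (@complexI R).
by rewrite -rnormE normrM !rnormE rmorphM.
Qed.

End RNorm.

Section Lipschitz.
Variables (R : realType) (G : graph).
Implicit Types (a v w : G) (f g : G -> R[i]).

Definition edge_variations f : set R :=
  [set r | exists v w, adj v w /\ r = rnorm (f v - f w)].

Definition lipschitz_fun : {pred G -> R[i]} :=
  [pred f : G -> R[i] | `[< has_ubound (edge_variations f) >]].

Definition lipschitz_norm a f : R := rnorm (f a) + sup (edge_variations f).

(* max_(w in N_v) |f v - f w| *)
Definition max_variation f v : R :=
  sup [set rnorm (f v - f w) | w in [set w | adj v w]].

Definition little_lipschitz_fun a : {pred G -> R[i]} :=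
  [pred f : G -> R[i] | (f \in lipschitz_fun) && `[< forall e : R, 0 < e ->
     exists N, forall v, (N < gdist a v)%N -> max_variation f v < e >]].

Lemma le_variation f v w : f \in lipschitz_fun -> adj v w ->
  rnorm (f v - f w) <= sup (edge_variations f).
Proof. by move=> /asboolP fl vw; apply: ub_le_sup => //; exists v, w. Qed.

Lemma sup_le_ge0 (A : set R) (r : R) : 0 <= r -> ubound A r -> sup A <= r.
Proof.
by move=> r0 Ar; have [->|/set0P A0] := eqVneq A set0;
  [rewrite sup0 | exact: ge_sup].
Qed.

Lemma sup_nonneg_ge0 (A : set R) : (forall r, A r -> 0 <= r) -> 0 <= sup A.
Proof.
move=> A0; have [->|/set0P [r Ar]] := eqVneq A set0; first by rewrite sup0.
have [ubA|nubA] := pselect (has_ubound A).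
  by rewrite (le_trans (A0 _ Ar))// ub_le_sup.
by rewrite sup_out// => -[].
Qed.

Lemma sup_variations_ge0 f : 0 <= sup (edge_variations f).
Proof.
by apply: sup_nonneg_ge0 => _ [v [w [_ ->]]]; exact: rnorm_ge0.
Qed.

Lemma variationD f g v w :
  rnorm ((f + g) v - (f + g) w) <= rnorm (f v - f w) + rnorm (g v - g w).
Proof.
have -> : (f + g) v - (f + g) w = (f v - f w) + (g v - g w).
  by rewrite !fctE opprD addrACA.
exact: rnormD.
Qed.

Lemma variationZ c f v w :
  rnorm ((c *: f) v - (c *: f) w) = rnorm c * rnorm (f v - f w).
Proof. by rewrite -rnormM mulrBr. Qed.

Lemma sup_variationsD f g : f \in lipschitz_fun -> g \in lipschitz_fun ->
  ubound (edge_variations (f + g))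
    (sup (edge_variations f) + sup (edge_variations g)).
Proof.
move=> fl gl _ [v [w [vw ->]]].
by rewrite (le_trans (variationD _ _ _ _))// lerD// le_variation.
Qed.

Lemma sup_variationsZ c f : f \in lipschitz_fun ->
  ubound (edge_variations (c *: f)) (rnorm c * sup (edge_variations f)).
Proof.
move=> fl _ [v [w [vw ->]]].
by rewrite variationZ ler_wpM2l ?rnorm_ge0// le_variation.
Qed.

Lemma lipschitz_submod_closed : subsemimod_closed lipschitz_fun.
Proof.
split=> [|c f fl]; last first.
  by apply/asboolP; eexists; exact: sup_variationsZ.
split=> [|f g fl gl]; apply/asboolP.
  by exists 0 => _ [v [w [_ ->]]]; rewrite subrr rnorm0.
by eexists; exact: sup_variationsD.
Qed.

Lemma le_max_variation f v w : f \in lipschitz_fun -> adj v w ->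
  rnorm (f v - f w) <= max_variation f v.
Proof.
move=> fl vw; apply: ub_le_sup; last by exists w.
exists (sup (edge_variations f)) => _ [u vu <-]; exact: le_variation.
Qed.

Lemma max_variation_ge0 f v : 0 <= max_variation f v.
Proof. by apply: sup_nonneg_ge0 => _ [w _ <-]; exact: rnorm_ge0. Qed.

Lemma max_variation0 v : max_variation 0 v = 0.
Proof.
apply/eqP; rewrite eq_le max_variation_ge0 andbT sup_le_ge0//.
by move=> _ [w _ <-]; rewrite subrr rnorm0.
Qed.

Lemma max_variationD f g v : f \in lipschitz_fun -> g \in lipschitz_fun ->
  max_variation (f + g) v <= max_variation f v + max_variation g v.
Proof.
move=> fl gl; apply: sup_le_ge0; first by rewrite addr_ge0 ?max_variation_ge0.
move=> _ [w vw <-]; rewrite (le_trans (variationD _ _ _ _))//.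
by rewrite lerD// le_max_variation.
Qed.

Lemma max_variationZ c f v : f \in lipschitz_fun ->
  max_variation (c *: f) v <= rnorm c * max_variation f v.
Proof.
move=> fl; apply: sup_le_ge0; first by rewrite mulr_ge0 ?rnorm_ge0 ?max_variation_ge0.
by move=> _ [w vw <-]; rewrite variationZ ler_wpM2l ?rnorm_ge0 ?le_max_variation.
Qed.

Lemma little_lipschitz_submod_closed a : subsemimod_closed (little_lipschitz_fun a).
Proof.
split=> [|c f /andP[fl /asboolP f0]]; last first.
  apply/andP; split; first exact: lipschitz_submod_closed.2.
  apply/asboolP => e e0; have c0 := rnorm_ge0 c.
  have c1 : 0 < rnorm c + 1 by rewrite ltr_wpDl.
  have [N Nf] := f0 (e / (rnorm c + 1)) (divr_gt0 e0 c1).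
  exists N => v /Nf fv; apply: (le_lt_trans (max_variationZ c v fl)).
  move: fv; rewrite ltr_pdivlMr// mulrDr mulr1 mulrC; apply: le_lt_trans.
  by rewrite lerDl max_variation_ge0.
split=> [|f g /andP[fl /asboolP f0] /andP[gl /asboolP g0]].
  apply/andP; split; first exact: lipschitz_submod_closed.1.1.
  by apply/asboolP => e e0; exists 0%N => v _; rewrite max_variation0.
apply/andP; split; first exact: lipschitz_submod_closed.1.2.
apply/asboolP => e e0; have e20 : 0 < e / 2 by rewrite divr_gt0.
have [[N Nf] [M Mg]] := (f0 _ e20, g0 _ e20).
exists (maxn N M) => v; rewrite gtn_max => /andP[/Nf fv /Mg gv].
rewrite (le_lt_trans (max_variationD v fl gl))//.
by rewrite [ltRHS]splitr ltrD.
Qed.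

Lemma lipschitz_normD a f g : f \in lipschitz_fun -> g \in lipschitz_fun ->
  lipschitz_norm a (f + g) <= lipschitz_norm a f + lipschitz_norm a g.
Proof.
move=> fl gl; rewrite /lipschitz_norm addrACA lerD ?rnormD// sup_le_ge0//.
  by rewrite addr_ge0 ?sup_variations_ge0.
exact: sup_variationsD.
Qed.

Lemma lipschitz_normZ a c f : f \in lipschitz_fun ->
  lipschitz_norm a (c *: f) = rnorm c * lipschitz_norm a f.
Proof.
move=> fl; rewrite /lipschitz_norm mulrDr -rnormM; congr (_ + _).
apply/eqP; rewrite eq_le; apply/andP; split.
  apply: sup_le_ge0; last exact: sup_variationsZ.
  by rewrite mulr_ge0 ?rnorm_ge0 ?sup_variations_ge0.
have [->|cn0] := eqVneq (rnorm c) 0; first by rewrite mul0r sup_variations_ge0.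
have c0 : 0 < rnorm c by rewrite lt_def cn0 rnorm_ge0.
rewrite mulrC -ler_pdivlMr// sup_le_ge0//.
  by rewrite divr_ge0 ?sup_variations_ge0// ltW.
move=> _ [v [w [vw ->]]]; rewrite ler_pdivlMr// mulrC -variationZ.
by apply: le_variation => //; exact: lipschitz_submod_closed.2.
Qed.

Lemma lipschitz_norm0_eq0 a f : f \in lipschitz_fun ->
  lipschitz_norm a f = 0 -> f = 0.
Proof.
move=> fl /eqP; rewrite paddr_eq0 ?rnorm_ge0 ?sup_variations_ge0//.
move=> /andP[/eqP/rnorm0_eq0 fa0 /eqP s0].
suff fconst p v : path (@adj G) v p -> f (last v p) = f v.
  by apply/funext => v; have [p [ap <-]] := adj_connected a v; rewrite fconst.
elim: p v => //= w p IH v /andP[vw /IH ->].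
apply/eqP; rewrite eq_sym -subr_eq0; apply/eqP/rnorm0_eq0/eqP.
by rewrite eq_le rnorm_ge0 andbT -s0 le_variation.
Qed.

End Lipschitz.

(* The base point is part of both types because the norm depends on it. *)
Record lipschitz_space (R : realType) (G : graph) (a : G) := LipschitzFun {
  lipschitz_val :> G -> R[i];
  _ : lipschitz_val \in @lipschitz_fun R G
}.

Record little_lipschitz_space (R : realType) (G : graph) (a : G) := LittleLipschitzFun {
  little_lipschitz_val :> G -> R[i];
  _ : little_lipschitz_val \in @little_lipschitz_fun R G a
}.

Section Spaces.
Variables (R : realType) (G : graph) (a : G).
Local Notation lipschitz_space := (lipschitz_space R a).
Local Notation little_lipschitz_space := (little_lipschitz_space R a).

HB.instance Definition _ := [isSub for @lipschitz_val R G a].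
HB.instance Definition _ := [Choice of lipschitz_space by <:].
HB.instance Definition _ := GRing.SubChoice_isSubLmodule.Build R[i] (G -> R[i])
  (@lipschitz_fun R G) lipschitz_space (@lipschitz_submod_closed R G).

HB.instance Definition _ := [isSub for @little_lipschitz_val R G a].
HB.instance Definition _ := [Choice of little_lipschitz_space by <:].
HB.instance Definition _ := GRing.SubChoice_isSubLmodule.Build R[i] (G -> R[i])
  (@little_lipschitz_fun R G a) little_lipschitz_space
  (@little_lipschitz_submod_closed R G a).

Lemma little_lipschitzW (f : little_lipschitz_space) :
  val f \in @lipschitz_fun R G.
Proof. by have /andP[] := valP f. Qed.

Let lip_norm (f : lipschitz_space) : R[i] := ((lipschitz_norm a (val f))%:C)%C.

Let lip_normD f g : lip_norm (f + g) <= lip_norm f + lip_norm g.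
Proof.
by rewrite -rmorphD/= lecR raddfD; apply: lipschitz_normD; exact: valP.
Qed.

Let lip_normZ c f : lip_norm (c *: f) = `|c| * lip_norm f.
Proof.
rewrite rnormE -rmorphM/= /lip_norm linearZ lipschitz_normZ//.
exact: valP.
Qed.

Let lip_norm0 f : lip_norm f = 0 -> f = 0.
Proof.
move=> /complexI f0; apply: val_inj.
by rewrite (lipschitz_norm0_eq0 (valP f) f0).
Qed.

HB.instance Definition _ := Lmodule_isNormed.Build R[i] lipschitz_space
  lip_normD lip_normZ lip_norm0.

Let little_norm (f : little_lipschitz_space) : R[i] :=
  ((lipschitz_norm a (val f))%:C)%C.

Let little_normD f g : little_norm (f + g) <= little_norm f + little_norm g.
Proof.
by rewrite -rmorphD/= lecR raddfD; apply: lipschitz_normD; exact: little_lipschitzW.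
Qed.

Let little_normZ c f : little_norm (c *: f) = `|c| * little_norm f.
Proof.
rewrite rnormE -rmorphM/= /little_norm linearZ lipschitz_normZ//.
exact: little_lipschitzW.
Qed.

Let little_norm0 f : little_norm f = 0 -> f = 0.
Proof.
move=> /complexI f0.
by apply: val_inj; rewrite (lipschitz_norm0_eq0 (little_lipschitzW f) f0).
Qed.

HB.instance Definition _ := Lmodule_isNormed.Build R[i] little_lipschitz_space
  little_normD little_normZ little_norm0.

Lemma rnorm_lipschitzE (f : lipschitz_space) :
  rnorm f = lipschitz_norm a (val f).
Proof. by []. Qed.

Lemma rnorm_little_lipschitzE (f : little_lipschitz_space) :
  rnorm f = lipschitz_norm a (val f).
Proof. by []. Qed.

(* [insubd 0] makes M_psi total: M_psi f is psi * f if that function is in the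
   space, and 0 otherwise. Under the predicates [.._bounded] below the second
   case does not occur. *)
Definition mul_lipschitz (psi : G -> R[i]) (f : lipschitz_space) :
  lipschitz_space := insubd 0 (psi * val f).

Definition mul_little_lipschitz (psi : G -> R[i]) (f : little_lipschitz_space) :
  little_lipschitz_space := insubd 0 (psi * val f).

Definition mul_lipschitz_bounded (psi : G -> R[i]) : Prop :=
  (forall f, f \in @lipschitz_fun R G -> psi * f \in @lipschitz_fun R G) /\
  bounded_operator (mul_lipschitz psi).

Definition mul_little_lipschitz_bounded (psi : G -> R[i]) : Prop :=
  (forall f, f \in @little_lipschitz_fun R G a ->
     psi * f \in @little_lipschitz_fun R G a) /\
  bounded_operator (mul_little_lipschitz psi).

(* [sup set0 = 0] in the library. *)
Definition Apsi (psi : G -> R[i]) : R :=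
  limn (fun n => sup [set rnorm (psi v) | v in [set v | (n <= gdist a v)%N]]).

Definition Bpsi (psi : G -> R[i]) : R :=
  limn (fun n => sup [set r : R | exists v w,
    [/\ adj v w, (n <= gdist a v)%N, (n <= gdist a w)%N &
        r = (gdist a v)%:R * rnorm (psi v - psi w)]]).

End Spaces.

Arguments mul_lipschitz {R G} a psi.
Arguments mul_little_lipschitz {R G} a psi.
Arguments mul_lipschitz_bounded {R G} a psi.
Arguments mul_little_lipschitz_bounded {R G} a psi.
Arguments Apsi {R G} a psi.
Arguments Bpsi {R G} a psi.

(* Main.v *)
Require Import Defs.
From mathcomp Require Import all_boot all_order all_algebra.
From mathcomp Require Import all_classical all_reals all_analysis.
From mathcomp Require Import complex ring lra zify.

(** The operator [M_psi] is compared with [M_(psi (1 - chi_n))], where the cutoff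
    [chi_n] vanishes on the ball of radius [n] about [a], equals 1 off the ball of
    radius [2 n], and grows linearly in between. Balls are finite because [G] is
    locally finite, so multiplication by the finitely supported function
    [psi (1 - chi_n)] has finite rank, hence is compact
    ([finite_rank_compact]), and the essential norm of [M_psi] is at most the norm
    of multiplication by [psi chi_n].

    That norm is estimated in [cutoff_mul_norm]. A function [f] of Lipschitz norm
    [N] satisfies [|f v| <= d(a,v) N] for [v <> a]. On an edge [v ~ w] with
    [d(a,w) <= d(a,v)],
[[
      (psi chi f) v - (psi chi f) w = psi v * chi v * (f v - f w)
                                      + psi v * (chi v - chi w) * f w
                                      + (psi v - psi w) * chi w * f w.
]]
    Let [A_n] and [B_n] be the suprema whose limits are [A(psi)] and [B(psi)].
    The first term is at most [A_n N]. The second is nonzero only if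
    [d(a,w) < 2 n], and then it is at most [A_n * (1/n) * (2 n N)]. The third is
    at most [B_n N]. Hence the essential norm is at most
    [3 A_n + B_n <= 4 A_n + B_n] for all [n > 0], and [n] tends to infinity.

    The limits are meaningful because boundedness of [M_psi] bounds [|psi v|] and
    [d(a,v) |psi v - psi w|] ([bounded_mul_symbol]): test [M_psi] on indicators of
    vertices and on truncated distances [min(d(a,.), n)]. These functions lie in
    both spaces, so boundedness on either one gives the two bounds, and the bounds
    imply that multiplication by [psi] preserves both spaces
    ([mul_lipschitz_closed], [mul_little_lipschitz_closed]). Apart from
    these two facts the argument is carried out once, for a normed space [X] with an isometric linear
    embedding [ev] into the functions on [G]. *)

Set Implicit Arguments.
Unset Strict Implicit.
Unset Printing Implicit Defensive.

Import Order.TTheory GRing.Theory Num.Theory.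
Import numFieldNormedType.Exports.

Local Open Scope classical_set_scope.
Local Open Scope ring_scope.

(** * The real-valued norm *)

Section Modulus.
Variable R : realType.

Lemma rnormN (X : normedZmodType R[i]) (x : X) : rnorm (- x) = rnorm x.
Proof. by rewrite /rnorm normrN. Qed.

Lemma rnorm_distC (X : normedZmodType R[i]) (x y : X) :
  rnorm (x - y) = rnorm (y - x).
Proof. by rewrite -rnormN opprB. Qed.

Lemma rnormZ (X : normedModType R[i]) (c : R[i]) (x : X) :
  rnorm (c *: x) = rnorm c * rnorm x.
Proof. by apply: (@complexI R); rewrite -rnormE normrZ !rnormE rmorphM. Qed.

Lemma rnorm_sum (X : normedZmodType R[i]) (I : Type) (s : seq I) (F : I -> X) :
  rnorm (\sum_(i <- s) F i) <= \sum_(i <- s) rnorm (F i).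
Proof.
elim: s => [|i s IH]; first by rewrite !big_nil rnorm0.
by rewrite !big_cons (le_trans (rnormD _ _))// lerD2l.
Qed.

Lemma rnorm_real (x : R) : rnorm (x%:C)%C = `|x|.
Proof. by rewrite /rnorm normc_def/= expr0n/= addr0 sqrtr_sqr. Qed.

Lemma rnorm_nat (n : nat) : rnorm (n%:R : R[i]) = n%:R.
Proof. by rewrite -(rmorph_nat (real_complex R)) rnorm_real normr_nat. Qed.

Lemma Re_le_rnorm (z : R[i]) : `|complex.Re z| <= rnorm z.
Proof. by have := normc_ge_Re z; rewrite rnormE lecR. Qed.

Lemma Im_le_rnorm (z : R[i]) : `|complex.Im z| <= rnorm z.
Proof.
by rewrite /rnorm normc_def/= -sqrtr_sqr ler_sqrt ?lerDr ?sqr_ge0// addr_ge0// sqr_ge0.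
Qed.

End Modulus.

(** * Graph distance and balls *)

Section Distance.
Variable G : graph.
Implicit Types (a u v w : G).

Lemma gdist_le_size v p : path (@adj G) v p -> (gdist v (last v p) <= size p)%N.
Proof.
move=> vp; rewrite /gdist; case: ex_minnP => m _; apply.
by apply/asboolP; exists p.
Qed.

Lemma gdist_geodesic v w :
  exists p, [/\ path (@adj G) v p, last v p = w & size p = gdist v w].
Proof. by rewrite /gdist; case: ex_minnP => m /asboolP. Qed.

Lemma gdistxx v : gdist v v = 0%N.
Proof. by apply/eqP; rewrite -leqn0 (gdist_le_size (p := [::])). Qed.

Lemma gdist_adj a v w : adj v w -> (gdist a w <= (gdist a v).+1)%N.
Proof.
move=> vw; have [p [ap pv <-]] := gdist_geodesic a v.
have := @gdist_le_size a (rcons p w).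
by rewrite last_rcons size_rcons rcons_path ap pv vw; apply.
Qed.

(** The last step of a geodesic from [a] to [v]; this makes induction on the
    distance to [a] possible. *)
Lemma gdist_succ a v n : gdist a v = n.+1 ->
  exists u, adj u v /\ gdist a u = n.
Proof.
move=> avn; have [p [ap pv]] := gdist_geodesic a v; rewrite avn.
case/lastP: p => // p u in ap pv *; rewrite size_rcons => -[pn].
move: ap pv; rewrite rcons_path last_rcons => /andP[ap pu] uv.
rewrite -{}uv in avn *; exists (last a p); split=> //.
apply/eqP; rewrite eqn_leq -{1}pn gdist_le_size//=.
by have := gdist_adj a pu; rewrite avn.
Qed.

(** The ball of radius [n + 1] is covered by the ball of radius [n] and the
    finitely many neighbourhoods of its vertices. *)
Lemma finite_gball a n : finite_set [set v | (gdist a v <= n)%N].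
Proof.
elim: n => [|n IH].
  apply: (@sub_finite_set _ _ [set a]) (finite_set1 _) => v /=.
  rewrite leqn0 => /eqP av.
  by have [p [_ pv]] := gdist_geodesic a v; rewrite av => /size0nil p0; rewrite -pv p0.
pose B := \bigcup_(u in [set u | (gdist a u <= n)%N]) [set w | adj u w].
apply: (@sub_finite_set _ _ ([set v | (gdist a v <= n)%N] `|` B)).
  move=> v /=; rewrite leq_eqVlt => /orP[/eqP/gdist_succ[u [uv un]]|]; last by left.
  by right; exists u => //=; rewrite un.
rewrite finite_setU; split=> //.
by apply: bigcup_finite => // u _; exact: adj_locally_finite.
Qed.

End Distance.

(** * Growth of Lipschitz functions and bounded symbols *)

Section Multiplication.
Variables (R : realType) (G : graph) (a : G).
Implicit Types (f psi : G -> R[i]) (u v w : G).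

Lemma lipschitz_norm_ge0 f : 0 <= lipschitz_norm a f.
Proof. by rewrite addr_ge0 ?rnorm_ge0 ?sup_variations_ge0. Qed.

Lemma variation_le_norm f v w : f \in @lipschitz_fun R G -> adj v w ->
  rnorm (f v - f w) <= lipschitz_norm a f.
Proof.
by move=> fl vw; rewrite (le_trans (Defs.le_variation fl vw))// lerDr rnorm_ge0.
Qed.

(** Telescoping along a geodesic from [a] to [v]. *)
Lemma lipschitz_growth f v : f \in @lipschitz_fun R G ->
  rnorm (f v) <= rnorm (f a) + (gdist a v)%:R * sup (edge_variations f).
Proof.
move=> fl; move dn : (gdist a v) => n; elim: n v dn => [|n IH] v dn.
  have [p [_ pv]] := gdist_geodesic a v; move: pv; rewrite dn mul0r addr0.
  by move=> + /size0nil p0; rewrite p0 => /= ->.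
have [u [uv un]] := gdist_succ dn.
have := rnormD (f v - f u) (f u); rewrite subrK => /le_trans; apply.
rewrite rnorm_distC -natr1 mulrDl mul1r addrA [leLHS]addrC.
by rewrite lerD ?IH// Defs.le_variation.
Qed.

(** Since [n >= 1], the term [|f a|] of the norm pays for the value at [a]. *)
Lemma lipschitz_growth_norm f v n : f \in @lipschitz_fun R G ->
  (gdist a v <= n)%N -> (0 < n)%N ->
  rnorm (f v) <= n%:R * lipschitz_norm a f.
Proof.
move=> fl vn n0; rewrite (le_trans (lipschitz_growth v fl))//.
rewrite /lipschitz_norm mulrDr lerD ?ler_wpM2r ?sup_variations_ge0 ?ler_nat//.
by rewrite ler_peMl ?rnorm_ge0// ler1n.
Qed.

(** A little Lipschitz function grows sublinearly: on a geodesic only the first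
    [N] steps cost more than [e] each. *)
Lemma little_lipschitz_growth f (e : R) :
  f \in @little_lipschitz_fun R G a -> 0 < e ->
  exists C, forall v, rnorm (f v) <= C + e * (gdist a v)%:R.
Proof.
move=> /andP[fl /asboolP f0] e0; have [N fN] := f0 e e0.
exists (rnorm (f a) + N%:R * sup (edge_variations f)) => v.
move dn : (gdist a v) => n; elim: n v dn => [|n IH] v dn.
  rewrite mulr0 addr0 (le_trans (lipschitz_growth v fl))// lerD2l dn mul0r.
  by rewrite mulr_ge0 ?sup_variations_ge0.
have [vN|Nv] := leqP (gdist a v) N.
  rewrite (le_trans (lipschitz_growth v fl))// ler_wpDr ?mulr_ge0 ?(ltW e0)//.
  by rewrite lerD2l ler_wpM2r ?sup_variations_ge0// ler_nat.
have [u [uv un]] := gdist_succ dn.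
have := rnormD (f v - f u) (f u); rewrite subrK => /le_trans; apply.
rewrite -natr1 mulrDr mulr1 addrA [leLHS]addrC lerD ?IH//.
by rewrite ltW// (le_lt_trans _ (fN _ Nv))// le_max_variation// adj_sym.
Qed.

Section BoundedSymbol.
Variables (psi : G -> R[i]) (P Q : R).
Hypothesis psiP : forall v, rnorm (psi v) <= P.
Hypothesis psiQ : forall v w, adj v w ->
  (gdist a v)%:R * rnorm (psi v - psi w) <= Q.

Lemma mul_variation f v w :
  rnorm ((psi * f) v - (psi * f) w) <=
    P * rnorm (f v - f w) + rnorm (f v) * rnorm (psi v - psi w).
Proof.
have -> : (psi * f) v - (psi * f) w = psi w * (f v - f w) + f v * (psi v - psi w).
  by rewrite !fctE; ring.
by rewrite (le_trans (rnormD _ _))// !rnormM lerD2r ler_wpM2r ?rnorm_ge0.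
Qed.

(** [|f v|] may grow like [d(a,v)], which the decay of [psi v - psi w]
    compensates. *)
Lemma mul_lipschitz_closed f :
  f \in @lipschitz_fun R G -> psi * f \in @lipschitz_fun R G.
Proof.
move=> fl; have P0 : 0 <= P by rewrite (le_trans _ (psiP a)) ?rnorm_ge0.
apply/asboolP; pose L := lipschitz_norm a f.
have L0 : 0 <= L := lipschitz_norm_ge0 f.
exists (P * L + (L * (P + P) + L * Q)) => _ [v [w [vw ->]]].
rewrite (le_trans (mul_variation _ _ _))// lerD//.
  by rewrite ler_wpM2l// variation_le_norm.
have fv : rnorm (f v) <= (gdist a v).+1%:R * L by apply: lipschitz_growth_norm.
rewrite (le_trans (ler_wpM2r (rnorm_ge0 _) fv))// mulrC mulrA mulrC -mulrDr.
rewrite ler_wpM2l// -natr1 mulrDr mulr1 addrC lerD//; last by rewrite mulrC psiQ.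
by rewrite (le_trans (rnormD _ _))// rnormN lerD.
Qed.

(** Both terms of [mul_variation] tend to 0: the first since the variation of [f]
    does, the second since [f v] is [o(d(a,v))] while [psi v - psi w] is
    [O(1/d(a,v))]. *)
Lemma mul_little_lipschitz_closed f :
  f \in @little_lipschitz_fun R G a -> psi * f \in @little_lipschitz_fun R G a.
Proof.
move=> fl; have /andP[fL /asboolP f0] := fl.
apply/andP; split; [exact: mul_lipschitz_closed | apply/asboolP => e e0].
have P0 : 0 <= P by rewrite (le_trans _ (psiP a)) ?rnorm_ge0.
have Q0 : 0 <= `|Q| := normr_ge0 Q.
have D0 : 0 < P + `|Q| + 1 by rewrite ltr_wpDl// addr_ge0.
(* The three error terms below then add up to [e / 2]. *)
pose d := e / (P + `|Q| + 1) / 2.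
have d0 : 0 < d by rewrite !divr_gt0.
have [N fN] := f0 d d0; have [C fC] := little_lipschitz_growth fl d0.
have [M CM] : exists M : nat, `|C| * `|Q| / d <= M%:R.
  exists (Num.bound (`|C| * `|Q| / d)); apply/ltW/archi_boundP.
  exact: divr_ge0 (mulr_ge0 (normr_ge0 C) (normr_ge0 Q)) (ltW d0).
exists (maxn N M) => v; rewrite gtn_max => /andP[Nv Mv].
apply: (@le_lt_trans _ _ (e / 2)); last by lra.
apply: sup_le_ge0 => [|_ [w vw <-]]; first lra.
have -> : e / 2 = P * d + (d + d * `|Q|).
  by rewrite /d; field; rewrite gt_eqF.
rewrite (le_trans (mul_variation _ _ _))// lerD//.
  by rewrite ler_wpM2l// ltW// (le_lt_trans _ (fN _ Nv))// le_max_variation.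
rewrite (le_trans (ler_wpM2r (rnorm_ge0 _) (fC v)))// mulrDl lerD//; last first.
  rewrite -mulrA ler_wpM2l ?(ltW d0)// (le_trans _ (ler_norm Q))// psiQ//.
have dv0 : 0 < (gdist a v)%:R :> R by rewrite ltr0n (leq_ltn_trans _ Mv).
have vQ : rnorm (psi v - psi w) <= `|Q| / (gdist a v)%:R.
  by rewrite ler_pdivlMr// mulrC (le_trans (psiQ vw))// ler_norm.
rewrite (@le_trans _ _ (`|C| * (`|Q| / (gdist a v)%:R)))//.
  by rewrite (le_trans (ler_wpM2r (rnorm_ge0 _) (ler_norm C)))// ler_wpM2l.
rewrite mulrA ler_pdivrMr// [leRHS]mulrC -ler_pdivrMr// (le_trans CM)// ler_nat ltnW//.
Qed.

End BoundedSymbol.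
End Multiplication.

(** * Multiplication by a cutoff symbol *)

Section Cutoff.
Variables (R : realType) (G : graph) (a : G).
Implicit Types (f psi : G -> R[i]) (u v w : G) (n : nat).

(** The truncated subtraction makes this vanish on the ball of radius [n]. *)
Definition cutoff n v : R := (minn (gdist a v) (2 * n) - n)%:R / n%:R.

Lemma cutoff_ge0 n v : 0 <= cutoff n v.
Proof. by rewrite divr_ge0. Qed.

Lemma cutoff_le1 n v : cutoff n v <= 1.
Proof.
have [->|n0] := posnP n; first by rewrite /cutoff invr0 mulr0 ler01.
rewrite ler_pdivrMr ?ltr0n// mul1r ler_nat leq_subLR addnn -mul2n.
exact: geq_minr.
Qed.

Lemma cutoff_eq0 n v : (gdist a v <= n)%N -> cutoff n v = 0.
Proof.
move=> vn; rewrite /cutoff (_ : (_ - _)%N = 0%N) ?mul0r//.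
by apply/eqP; rewrite subn_eq0 geq_min vn.
Qed.

Lemma cutoff_eq1 n v : (0 < n)%N -> (2 * n <= gdist a v)%N -> cutoff n v = 1.
Proof.
move=> n0 nv; rewrite /cutoff (minn_idPr nv) mul2n -addnn addnK divff//.
by rewrite pnatr_eq0 -lt0n.
Qed.

Lemma cutoff_variation n v w : adj v w -> (gdist a w <= gdist a v)%N ->
  `|cutoff n v - cutoff n w| <= n%:R^-1.
Proof.
move=> vw wv; rewrite -mulrBl normrM [`|_^-1|]ger0_norm ?invr_ge0//.
rewrite -[leRHS]mul1r ler_wpM2r ?invr_ge0//.
have vSw : (gdist a v <= (gdist a w).+1)%N by rewrite gdist_adj// adj_sym.
have h1 : (minn (gdist a w) (2 * n) - n <= minn (gdist a v) (2 * n) - n)%N by lia.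
have h2 : (minn (gdist a v) (2 * n) - n <= (minn (gdist a w) (2 * n) - n).+1)%N by lia.
by rewrite -natrB// normr_nat (ler_nat _ _ 1) leq_subLR addn1.
Qed.

(** [A] and [B] bound the symbol only at distance at least [n] from [a]: the cutoff
    kills every edge with both ends in the ball of radius [n], and an edge that
    leaves the ball has both ends at distance at least [n]. *)
Lemma cutoff_mul_norm f psi n (A B : R) : (0 < n)%N -> 0 <= A -> 0 <= B ->
  (forall v, (n <= gdist a v)%N -> rnorm (psi v) <= A) ->
  (forall v w, adj v w -> (n <= gdist a v)%N -> (n <= gdist a w)%N ->
    (gdist a v)%:R * rnorm (psi v - psi w) <= B) ->
  f \in @lipschitz_fun R G ->
  lipschitz_norm a (fun v => psi v * ((cutoff n v)%:C)%C * f v) <=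
    (3 * A + B) * lipschitz_norm a f.
Proof.
move=> n0 A0 B0 psiA psiB fl; set g := fun v => _; set N := lipschitz_norm a f.
have N0 : 0 <= N := lipschitz_norm_ge0 a f.
have ga : g a = 0 by rewrite /g cutoff_eq0 ?gdistxx// mulr0 mul0r.
rewrite {1}/lipschitz_norm ga rnorm0 add0r; apply: sup_le_ge0.
  by rewrite mulr_ge0// addr_ge0// mulr_ge0.
move=> _ [v [w [vw ->]]].
wlog wv : v w vw / (gdist a w <= gdist a v)%N.
  move=> H; case: (leqP (gdist a w) (gdist a v)) => [|/ltnW] h; first exact: H.
  by rewrite rnorm_distC H// adj_sym.
have [vn|nv] := leqP (gdist a v) n.
  rewrite /g !cutoff_eq0// ?(leq_trans wv)// !mulr0 !mul0r subrr rnorm0.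
  by rewrite mulr_ge0// addr_ge0// mulr_ge0.
have wn : (n <= gdist a w)%N.
  by rewrite -ltnS (leq_trans nv)// gdist_adj// adj_sym.
have w0 : (0 < gdist a w)%N := leq_trans n0 wn.
have -> : g v - g w = psi v * ((cutoff n v)%:C%C * (f v - f w))
    + psi v * ((cutoff n v - cutoff n w)%:C%C * f w)
    + (psi v - psi w) * ((cutoff n w)%:C%C * f w).
  by rewrite /g rmorphB/=; ring.
have -> : (3 * A + B) * N = A * N + A * (2 * N) + B * N by ring.
rewrite (le_trans (rnormD _ _))// lerD//.
  rewrite (le_trans (rnormD _ _))// lerD// rnormM ler_pM ?rnorm_ge0 ?psiA ?(ltnW nv)//.
    rewrite rnormM rnorm_real ger0_norm ?cutoff_ge0//.
    rewrite -[leRHS]mul1r ler_pM ?cutoff_ge0 ?rnorm_ge0 ?cutoff_le1//.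
    exact: variation_le_norm.
  have [wn2|nw2] := leqP (2 * n)%N (gdist a w).
    rewrite !cutoff_eq1// ?(leq_trans wn2)// subrr mul0r rnorm0.
    by rewrite mulr_ge0.
  rewrite rnormM rnorm_real.
  have -> : 2 * N = n%:R^-1 * ((2 * n)%:R * N).
    by rewrite natrM; field; rewrite pnatr_eq0 -lt0n.
  rewrite ler_pM ?rnorm_ge0 ?cutoff_variation//.
  by rewrite lipschitz_growth_norm// ?muln_gt0// ltnW.
rewrite !rnormM rnorm_real ger0_norm ?cutoff_ge0//.
rewrite (@le_trans _ _ (rnorm (psi v - psi w) * ((gdist a w)%:R * N)))//.
  rewrite ler_wpM2l ?rnorm_ge0// -[leRHS]mul1r.
  by rewrite ler_pM ?cutoff_ge0 ?rnorm_ge0 ?cutoff_le1// lipschitz_growth_norm.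
rewrite mulrA ler_wpM2r// mulrC rnorm_distC psiB ?(ltnW nv)// adj_sym//.
Qed.

End Cutoff.

(** * Finite-rank operators are compact *)

Section FiniteRank.
Variables (R : realType) (X : normedModType R[i]).

Lemma compact_real_segment (u : X) (c : R) :
  compact [set (x%:C)%C *: u | x in `[- c, c]].
Proof.
apply: continuous_compact; last exact: segment_compact.
apply: continuous_subspaceT => x; apply/cvgrPdist_lt => -[r r'].
rewrite ltcE /= => /andP[/eqP -> r0].
have u0 : 0 < rnorm u + 1 by rewrite ltr_wpDl// rnorm_ge0.
near=> t.
rewrite -scalerBl -rmorphB/= rnormE ltcR rnormZ rnorm_real.
apply: (@le_lt_trans _ _ (`|x - t| * (rnorm u + 1))).
  by rewrite ler_wpM2l// lerDl.
rewrite -ltr_pdivlMr//; near: t.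
by apply: cvgr_dist_lt; [exact: cvg_id | exact: divr_gt0].
Unshelve. all: by end_near. Qed.

Lemma compact_sumset (A B : set X) : compact A -> compact B ->
  compact [set p.1 + p.2 | p in A `*` B].
Proof.
move=> cA cB; apply: continuous_compact; last exact: compact_setX.
exact: continuous_subspaceT (@add_continuous X).
Qed.

(** Splitting each coefficient into real and imaginary parts puts the combination
    in a Minkowski sum of finitely many compact real segments. *)
Lemma compact_combinations (I : Type) (e : I -> X) (s : seq I) (c : R) :
  exists S : set X, compact S /\ forall z : I -> R[i],
    (forall i, rnorm (z i) <= c) -> S (\sum_(i <- s) z i *: e i).
Proof.
elim: s => [|i s [S [cS Sz]]].
  by exists [set 0]; split=> [|z _]; [exact: compact_set1 | rewrite big_nil].
have cD : compact [set p.1 + p.2 | p in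
    [set (x%:C)%C *: e i | x in `[- c, c]] `*`
    [set (x%:C)%C *: (('i)%C *: e i) | x in `[- c, c]]].
  by apply: compact_sumset; exact: compact_real_segment.
eexists; split; first exact: compact_sumset cD cS.
move=> z zc; rewrite big_cons.
exists (z i *: e i, \sum_(j <- s) z j *: e j) => //; split; last exact: Sz.
exists ((complex.Re (z i))%:C%C *: e i, (complex.Im (z i))%:C%C *: ('i%C *: e i)).
  split.
    exists (complex.Re (z i)) => //=.
    by rewrite in_itv/= -ler_norml (le_trans (Re_le_rnorm _)).
  exists (complex.Im (z i)) => //=.
  by rewrite in_itv/= -ler_norml (le_trans (Im_le_rnorm _)).
by rewrite /= scalerA -scalerDl mulrC -complexE.
Qed.

Lemma finite_rank_compact (I : Type) (s : seq I) (l : I -> X -> R[i])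
    (e : I -> X) (C : R) :
  (forall i (k : R[i]) x y, l i (k *: x + y) = k * l i x + l i y) ->
  (forall i x, rnorm (l i x) <= C * rnorm x) ->
  compact_operator (fun x => \sum_(i <- s) l i x *: e i).
Proof.
move=> ll lC; split; first split.
- move=> k x y; rewrite scaler_sumr -big_split/=; apply: eq_bigr => i _.
  by rewrite ll scalerDl scalerA.
- exists (\sum_(i <- s) C * rnorm (e i)) => x.
  rewrite (le_trans (rnorm_sum _ _))// mulr_suml; apply: ler_sum => i _.
  by rewrite rnormZ mulrAC ler_wpM2r ?rnorm_ge0.
- have [S [cS Sz]] := compact_combinations e s `|C|.
  apply: precompact_subset (compact_precompact (@norm_hausdorff _ X) cS).
  move=> _ [x x1 <-]; apply: Sz => i; rewrite (le_trans (lC i x))//.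
  rewrite (le_trans (ler_wpM2r (rnorm_ge0 _) (ler_norm C)))//.
  by rewrite -[leRHS]mulr1 ler_wpM2l.
Qed.

End FiniteRank.

(** * Test functions *)

Section TestFunctions.
Variables (R : realType) (G : graph) (a : G).
Implicit Types (h : G -> nat) (u v w : G).

(** The test functions take natural values, so that their variations can be
    computed with truncated arithmetic in [nat]. *)
Definition natfun h : G -> R[i] := fun v => (h v)%:R.

Lemma natfun_variation h v w : (h v <= (h w).+1)%N -> (h w <= (h v).+1)%N ->
  rnorm (natfun h v - natfun h w) <= 1.
Proof.
wlog vw : v w / (h w <= h v)%N.
  move=> H; case: (leqP (h w) (h v)) => [|/ltnW] hvw h1 h2; first exact: H.
  by rewrite rnorm_distC H.
by move=> h1 _; rewrite -natrB// rnorm_nat (ler_nat _ _ 1); lia.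
Qed.

Definition one_lipschitz h := forall v w, adj v w -> (h w <= (h v).+1)%N.

Lemma natfun_edge h v w : one_lipschitz h -> adj v w ->
  rnorm (natfun h v - natfun h w) <= 1.
Proof. by move=> h1 vw; rewrite natfun_variation ?h1// adj_sym. Qed.

Lemma natfun_little_lipschitz h N : one_lipschitz h ->
  (forall v w, adj v w -> (N < gdist a v)%N -> h v = h w) ->
  natfun h \in @little_lipschitz_fun R G a.
Proof.
move=> h1 hN; apply/andP; split; apply/asboolP.
  by exists 1 => _ [v [w [vw ->]]]; exact: natfun_edge.
move=> r r0; exists N => v Nv; rewrite (le_lt_trans _ r0)//.
by apply: sup_le_ge0 => // _ [w vw <-]; rewrite /natfun (hN _ _ vw Nv) subrr rnorm0.
Qed.

Definition indicator u v : nat := `[< v = u >].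

Definition truncated_dist n v := minn (gdist a v) n.

Lemma indicator_little_lipschitz u :
  natfun (indicator u) \in @little_lipschitz_fun R G a.
Proof.
apply: (natfun_little_lipschitz (N := (gdist a u).+1)) => [v w _|v w vw uv].
  by rewrite /indicator; case: `[< w = u >]; case: `[< v = u >].
have ne x : (gdist a u < gdist a x)%N -> indicator u x = 0%N.
  by rewrite /indicator; case: asboolP => // ->; rewrite ltnn.
rewrite !ne// ?(ltn_trans _ uv)// -ltnS (leq_trans uv)// gdist_adj// adj_sym//.
Qed.

Lemma truncated_dist_one_lipschitz n : one_lipschitz (truncated_dist n).
Proof. by move=> v w vw; have := gdist_adj a vw; rewrite /truncated_dist; lia. Qed.

Lemma truncated_dist_little_lipschitz n :
  natfun (truncated_dist n) \in @little_lipschitz_fun R G a.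
Proof.
apply: (natfun_little_lipschitz (N := n) (@truncated_dist_one_lipschitz n)).
move=> v w; rewrite adj_sym => wv vn; have := gdist_adj a wv.
by rewrite /truncated_dist; lia.
Qed.

Lemma truncated_dist_norm n : lipschitz_norm a (natfun (truncated_dist n)) <= 1.
Proof.
rewrite /lipschitz_norm {1}/natfun /truncated_dist gdistxx min0n rnorm0 add0r.
apply: sup_le_ge0 => // _ [v [w [vw ->]]].
exact/natfun_edge/vw/truncated_dist_one_lipschitz.
Qed.

End TestFunctions.

(** * The essential norm of a multiplication operator *)

(** Tail suprema decrease and are bounded below by 0. *)
Lemma sup_tail_cvg (R : realType) (E : nat -> set R) (C : R) :
  (forall m n, (m <= n)%N -> E n `<=` E m) ->
  (forall n r, E n r -> 0 <= r <= C) -> cvgn (fun n => sup (E n)).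
Proof.
move=> Edec EC; apply: nonincreasing_is_cvgn => [m n mn|].
  apply: sup_le_ge0 => [|r /(Edec _ _ mn) Er].
    by apply: sup_nonneg_ge0 => r /EC/andP[].
  by apply: ub_le_sup => //; exists C => x /EC/andP[].
by exists 0 => _ [n _ <-]; apply: sup_nonneg_ge0 => r /EC/andP[].
Qed.

Section MultiplicationOperator.
Variables (R : realType) (G : graph) (a : G) (psi : G -> R[i]).
Variables (X : normedModType R[i]) (ev : {linear X -> (G -> R[i])}).
Variable M : X -> X.
Hypothesis ev_norm : forall x, rnorm x = lipschitz_norm a (ev x).
Hypothesis ev_lipschitz : forall x, ev x \in @lipschitz_fun R G.
Hypothesis ev_onto : forall f, f \in @little_lipschitz_fun R G a ->
  exists x, ev x = f.
Hypothesis ev_mul : forall x, ev (M x) = psi * ev x.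

(** The indicator of [v] is an eigenvector of [M_psi] for [psi v], which bounds
    [|psi v|]. For the other bound, [M_psi] is applied to the distance function
    truncated beyond both ends of the edge; it differs on the edge by at most 1,
    so the variation of its image is [d(a,v) |psi v - psi w|] up to [|psi w|]. *)
Lemma bounded_mul_symbol : bounded_operator M -> exists P Q,
  (forall v, rnorm (psi v) <= P) /\
  (forall v w, adj v w -> (gdist a v)%:R * rnorm (psi v - psi w) <= Q).
Proof.
move=> [_ [C MC]].
have psiC v : rnorm (psi v) <= C.
  have [x xv] := ev_onto (indicator_little_lipschitz R a v).
  have := MC x; rewrite ev_norm ev_mul.
  have -> : psi * ev x = psi v *: ev x.
    apply/funext => w; rewrite !fctE xv /natfun /indicator.
    by case: asboolP => [->|_] //; rewrite mulr0 scaler0.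
  rewrite lipschitz_normZ// -ev_norm ler_pM2r// lt_def rnorm_ge0 andbT.
  apply/eqP; rewrite ev_norm => /(lipschitz_norm0_eq0 (ev_lipschitz x)).
  rewrite xv => /(congr1 (@^~ v)); rewrite /natfun /indicator.
  by case: asboolP => // _ /eqP; rewrite oner_eq0.
exists C, (`|C| + C); split=> // v w vw.
have [x xv] := ev_onto (truncated_dist_little_lipschitz R a (gdist a v + gdist a w)).
have MxC : lipschitz_norm a (psi * ev x) <= `|C|.
  rewrite -ev_mul -ev_norm (le_trans (MC x))//.
  rewrite (le_trans (ler_wpM2r (rnorm_ge0 _) (ler_norm C)))//.
  by rewrite -[leRHS]mulr1 ler_wpM2l// ev_norm xv truncated_dist_norm.
have Mxl : psi * ev x \in @lipschitz_fun R G by rewrite -ev_mul ev_lipschitz.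
have := le_trans (variation_le_norm a Mxl vw) MxC.
have xE u : (gdist a u <= gdist a v + gdist a w)%N -> ev x u = (gdist a u)%:R.
  by move=> uvw; rewrite xv /natfun /truncated_dist (minn_idPl uvw).
rewrite !fctE !xE ?leq_addr ?leq_addl// => vwC.
rewrite -[X in X * _]rnorm_nat -rnormM.
have -> : (gdist a v)%:R * (psi v - psi w) =
    psi v * (gdist a v)%:R - psi w * (gdist a w)%:R
    - psi w * ((gdist a v)%:R - (gdist a w)%:R) by ring.
rewrite (le_trans (rnormD _ _))// lerD// rnormN rnormM -[leRHS]mulr1.
rewrite ler_pM ?rnorm_ge0// (natfun_variation _ (h := gdist a))//.
  by rewrite gdist_adj// adj_sym.
exact: gdist_adj.
Qed.

Variables (P Q : R).
Hypothesis psiP : forall v, rnorm (psi v) <= P.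
Hypothesis psiQ : forall v w, adj v w ->
  (gdist a v)%:R * rnorm (psi v - psi w) <= Q.

(** [K] is multiplication by [psi (1 - cutoff n)], written as a sum of rank-one
    operators over the vertices of the ball of radius [2 n]. *)
Lemma essential_norm_le (n : nat) (A B : R) : (0 < n)%N -> 0 <= A -> 0 <= B ->
  (forall v, (n <= gdist a v)%N -> rnorm (psi v) <= A) ->
  (forall v w, adj v w -> (n <= gdist a v)%N -> (n <= gdist a w)%N ->
    (gdist a v)%:R * rnorm (psi v - psi w) <= B) ->
  essential_norm M <= 3 * A + B.
Proof.
move=> n0 A0 B0 psiA psiB.
(* The vertices only form a Type; [{classic G}] is the same type with a
     classical decidable equality, as sequences without repetition require. *)
have /finite_seqP[s0 ballE] : finite_set ([set v | (gdist a v <= 2 * n)%N] : set {classic G}).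
  exact: finite_gball.
pose s := undup s0.
have sE v : (v \in s) = (gdist a v <= 2 * n)%N.
  rewrite mem_undup; apply/idP/idP => h.
    by have : [set` s0] v by []; rewrite -ballE.
  by have : [set v | (gdist a v <= 2 * n)%N] v by []; rewrite ballE.
have [e eE] := choice (fun v => ev_onto (indicator_little_lipschitz R a v)).
pose l v x := psi v * ((1 - cutoff R a n v)%:C)%C * ev x v.
pose K x := \sum_(v <- s) l v x *: e v.
have P0 : 0 <= P by rewrite (le_trans _ (psiP a)) ?rnorm_ge0.
have out v : (2 * n <= gdist a v)%N -> forall x, l v x = 0.
  by move=> nv x; rewrite /l cutoff_eq1// subrr mulr0 mul0r.
have cK : compact_operator K.
  apply: (@finite_rank_compact _ _ _ _ l e (P * (2 * n)%:R)) => [v k x y|v x].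
    by rewrite /l linearP/= !fctE /GRing.scale/=; ring.
  have [vn|/ltnW nv] := leqP (gdist a v) (2 * n); last first.
    by rewrite out// rnorm0 !mulr_ge0// rnorm_ge0.
  rewrite /l !rnormM rnorm_real -mulrA -mulrA ler_pM ?mulr_ge0 ?rnorm_ge0//.
  rewrite -[leRHS]mul1r ler_pM ?rnorm_ge0//.
    by rewrite ger0_norm ?subr_ge0 ?cutoff_le1// gerBl cutoff_ge0.
  by rewrite ev_norm lipschitz_growth_norm ?muln_gt0.
have evK x w : ev (K x) w = l w x.
  rewrite /K linear_sum fct_sumE.
  have evl u : ev (l u x *: e u) w = l u x * (indicator u w)%:R.
    by rewrite linearZ/= eE.
  under eq_bigr do rewrite evl.
  have [ws|/negP ws] := boolP ((w : {classic G}) \in s).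
    rewrite (bigD1_seq (w : {classic G})) ?undup_uniq//= big1 => [|u /eqP uw].
      by rewrite addr0 /indicator; case: asboolP => // _; rewrite mulr1.
    by rewrite /indicator; case: asboolP => [wu|_]; [case: uw | rewrite mulr0].
  rewrite big1_seq => [|u /andP[_ us]].
    by rewrite out// ltnW// ltnNge; apply/negP => h; apply: ws; rewrite sE.
  by rewrite /indicator; case: asboolP => [wu|_]; [case: ws; rewrite wu | rewrite mulr0].
apply: (@le_trans _ _ (operator_norm (M \- K))).
  apply: ge_inf; last by exists K.
  by exists 0 => _ [? _ <-]; apply: sup_nonneg_ge0 => _ [? _ <-]; exact: rnorm_ge0.
have D0 : 0 <= 3 * A + B by rewrite addr_ge0// mulr_ge0.
apply: sup_le_ge0 => // _ [x /= x1 <-].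
rewrite ev_norm linearB/=.
have -> : ev (M x) - ev (K x) =
    fun v => psi v * ((cutoff R a n v)%:C)%C * ev x v.
  apply/funext => w; rewrite ev_mul !fctE evK /l rmorphB rmorph1 /=; ring.
rewrite (le_trans (cutoff_mul_norm n0 A0 B0 psiA psiB (ev_lipschitz x)))//.
by rewrite -[leRHS]mulr1 ler_wpM2l// -ev_norm.
Qed.

Lemma essential_norm_le_lim : essential_norm M <= 4 * Apsi a psi + Bpsi a psi.
Proof.
pose EA n := [set rnorm (psi v) | v in [set v | (n <= gdist a v)%N]].
pose EB n := [set r : R | exists v w,
    [/\ adj v w, (n <= gdist a v)%N, (n <= gdist a w)%N &
        r = (gdist a v)%:R * rnorm (psi v - psi w)]].
have EA0 n r : EA n r -> 0 <= r <= P.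
  by move=> [v _ <-]; rewrite rnorm_ge0 psiP.
have EB0 n r : EB n r -> 0 <= r <= Q.
  by move=> [v [w [vw _ _ ->]]]; rewrite psiQ// mulr_ge0// rnorm_ge0.
have cA : cvgn (fun n => sup (EA n)).
  apply: sup_tail_cvg EA0 => m n mn _ [v /= nv <-].
  by exists v => //=; exact: leq_trans nv.
have cB : cvgn (fun n => sup (EB n)).
  apply: sup_tail_cvg EB0 => m n mn _ [v [w [vw nv nw ->]]].
  by exists v, w; split=> //; exact: leq_trans mn _.
have cAB : (4 * sup (EA n) + sup (EB n) @[n --> \oo] --> 4 * Apsi a psi + Bpsi a psi).
  by apply: cvgD cB; apply: cvgMr.
rewrite -(cvg_lim (@norm_hausdorff _ _) cAB); apply: limr_ge.
  by apply/cvg_ex; eexists; exact: cAB.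
exists 1%N => // n /= n0.
have A0 : 0 <= sup (EA n) by apply: sup_nonneg_ge0 => r /EA0/andP[].
have B0 : 0 <= sup (EB n) by apply: sup_nonneg_ge0 => r /EB0/andP[].
apply: (@le_trans _ _ (3 * sup (EA n) + sup (EB n))); last by lra.
apply: essential_norm_le n0 A0 B0 _ _ => [v nv|v w vw nv nw].
  apply: ub_le_sup; last by exists v.
  by exists P => r /EA0/andP[].
apply: ub_le_sup; last by exists v, w.
by exists Q => r /EB0/andP[].
Qed.

End MultiplicationOperator.

Theorem proposition8p3 (R : realType) (G : graph) (a : G) (psi : G -> R[i])
    (bounded_psi : mul_lipschitz_bounded a psi \/
                   mul_little_lipschitz_bounded a psi) :
  essential_norm (mul_lipschitz a psi) <= 4 * Apsi a psi + Bpsi a psi /\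
  essential_norm (mul_little_lipschitz a psi) <= 4 * Apsi a psi + Bpsi a psi.
Proof.
pose lip_ev : {linear lipschitz_space R a -> (G -> R[i])} := val.
pose little_ev : {linear little_lipschitz_space R a -> (G -> R[i])} := val.
have lip_mem (x : lipschitz_space R a) : val x \in @lipschitz_fun R G := valP x.
have little_mem (x : little_lipschitz_space R a) :
  val x \in @lipschitz_fun R G := little_lipschitzW x.
have lip_onto f : f \in @little_lipschitz_fun R G a ->
    exists x : lipschitz_space R a, val x = f.
  by move=> /andP[fl _]; exists (LipschitzFun a fl).
have little_onto f : f \in @little_lipschitz_fun R G a ->
    exists x : little_lipschitz_space R a, val x = f.
  by move=> fl; exists (LittleLipschitzFun fl).
have mulE : (forall f, f \in @lipschitz_fun R G -> psi * f \in @lipschitz_fun R G) ->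
    forall x, val (mul_lipschitz a psi x) = psi * val x.
  by move=> psil x; rewrite insubdK//; apply: psil.
have little_mulE : (forall f, f \in @little_lipschitz_fun R G a ->
      psi * f \in @little_lipschitz_fun R G a) ->
    forall x, val (mul_little_lipschitz a psi x) = psi * val x.
  by move=> psil x; rewrite insubdK//; apply: psil; exact: valP.
have [P [Q [psiP psiQ]]] : exists P Q, (forall v, rnorm (psi v) <= P) /\
    (forall v w, adj v w -> (gdist a v)%:R * rnorm (psi v - psi w) <= Q).
  case: bounded_psi => -[psil bpsi].
    exact: (bounded_mul_symbol (ev := lip_ev) (@rnorm_lipschitzE R G a)
      lip_mem lip_onto (mulE psil) bpsi).
  exact: (bounded_mul_symbol (ev := little_ev) (@rnorm_little_lipschitzE R G a)
    little_mem little_onto (little_mulE psil) bpsi).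
split.
  exact: (essential_norm_le_lim (ev := lip_ev) (@rnorm_lipschitzE R G a)
    lip_mem lip_onto (mulE (mul_lipschitz_closed psiP psiQ)) psiP psiQ).
exact: (essential_norm_le_lim (ev := little_ev) (@rnorm_little_lipschitzE R G a)
  little_mem little_onto (little_mulE (mul_little_lipschitz_closed psiP psiQ)) psiP psiQ).
Qed.
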